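(* Let $M\in\mathbb{R}^{n\times n}$ be symmetric and nonzero with $A:=I-M$ invertible, and let $\mathcal{R}$ and $X$ be the two-step residual propagator and the four-step residual propagation matrix defined in the context. Let $0\neq c_i,c_j\in\mathbb{R}$, and define $\mathbf{z}_{ij}(\varepsilon)$ as $$\mathbf{z}_{ij}(\varepsilon):=c_i\mathbf{v}_i+c_j\mathbf{v}_j=c_i(\mathbf{v}_i+\varepsilon\mathbf{v}_j),\qquad \varepsilon:=\frac{c_j}{c_i},$$ with $\mathbf{v}_i,\mathbf{v}_j$, $i\neq j$, two orthogonal eigenvectors of $M$ with eigenvalues $m_i$ and $m_j$, respectively. Then, if $m_i=m_j$, $$\mathcal{R}(\mathbf{z}_{ij}(\varepsilon))=\mathbf{0}.$$ Otherwise, if $m_i\neq m_j$, then $\mathbf{z}_{ij}(\varepsilon)$ solves the eigenvector-dependent nonlinear eigenvalue problem $X(\mathbf{z})\mathbf{z}=\lambda\mathbf{z}$ with corresponding eigenvalue $\lambda_{ij}(\varepsilon)\in\mathbb{R}$ given by $$\lambda_{ij}(\varepsilon)=\frac{(m_j-m_i)^2}{(m_i-1)^2+\varepsilon^2(m_j-1)^2}\cdot\frac{(m_im_j)^2}{m_i^2+\dfrac{m_j^2}{\varepsilon^2}}.$$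
   Context: $\langle\cdot,\cdot\rangle$ is the Euclidean inner product. With $A:=I-M$ invertible, define for $\mathbf{v}\in\mathbb{R}^n\setminus\{\mathbf{0}\}$ $$\alpha(\mathbf{v}):=\frac{\langle A\mathbf{v},\mathbf{v}\rangle}{\langle A\mathbf{v},A\mathbf{v}\rangle},\qquad \mathcal{R}(\mathbf{v}):=M\,[I-\alpha(\mathbf{v})A]\,\mathbf{v}.$$ For $\mathbf{v}\neq\mathbf{0}$ (with $\mathcal{R}(\mathbf{v})\neq\mathbf{0}$, so that the expression makes sense) define the vector-dependent symmetric matrix $$X(\mathbf{v}):=M^2\,[I-\alpha(\mathcal{R}(\mathbf{v}))A]\,[I-\alpha(\mathbf{v})A],$$ so that $X(\mathbf{v})\mathbf{v}=\mathcal{R}(\mathcal{R}(\mathbf{v}))$.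
   Formalization: For m_i ≠ m_j the formal theorem also assumes that v_i and v_j have equal Euclidean norm (e.g. both normalized); without this the eigenvalue formula fails, e.g. M = diag(2,3), v_i = e_1, v_j = 2e_2, c_i = c_j = 1. *)

(* Defs.v *)
From mathcomp Require Import all_boot all_order all_algebra.
From mathcomp Require Import reals.

Set Implicit Arguments.
Unset Strict Implicit.
Unset Printing Implicit Defensive.

Import Order.TTheory GRing.Theory Num.Theory.
Local Open Scope ring_scope.

Section Propagators.
Variables (R : realType) (n : nat).
Implicit Types (M : 'M[R]_n) (u v : 'cV[R]_n) (m lam : R).

Definition dot u v : R := \sum_(k < n) u k 0 * v k 0.

Definition is_eigenvector M m v : Prop := v <> 0 /\ M *m v = m *: v.

Definition Amx M : 'M[R]_n := 1%:M - M.

(* For invertible [Amx M] the denominator vanishes only at [v = 0]. *)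
Definition alpha M v : R :=
  dot (Amx M *m v) v / dot (Amx M *m v) (Amx M *m v).

Definition step M v : 'M[R]_n := 1%:M - alpha M v *: Amx M.

Definition propagator M v : 'cV[R]_n := M *m step M v *m v.

Definition Xmx M v : 'M[R]_n :=
  M *m M *m step M (propagator M v) *m step M v.

(* Division by zero is total here, so the domain of [Xmx M], namely the [v]
   with [v <> 0] and [propagator M v <> 0], is part of being a solution. *)
Definition solves_nepv M v lam : Prop :=
  [/\ v <> 0, propagator M v <> 0 & Xmx M v *m v = lam *: v].

End Propagators.

(* Main.v *)
Require Import Defs.
From mathcomp Require Import all_boot all_order all_algebra.
From mathcomp Require Import reals.
From mathcomp Require Import ring.

(** Write [a_i = 1 - m_i], [a_j = 1 - m_j] for the eigenvalues of [A]; they are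
    nonzero because [A] is invertible.

    If [m_i = m_j], then [z] is itself an eigenvector of [A], say for [a], so
    [alpha z = 1 / a] and the line search annihilates [z] in one step
    ([propagator_eigenvector]).

    If [m_i <> m_j] and the eigenvectors have the same length, the plane they
    span is invariant, and in the coordinates [(x, y)] of that plane the
    propagator is explicit ([propagator_pair]):
<<
      (x, y) |-> k (m_i a_j y, - m_j a_i x),
      k = x y (m_i - m_j) / (a_i^2 x^2 + a_j^2 y^2).
>>
    Up to the scalar [k] this is an anti-diagonal linear map, so it exchanges
    the two coordinates and its square is a multiple of the identity: two
    applications bring [z] back to its own line.  The factor of [z] is the
    claimed eigenvalue, and it remains to recognize two applications of the
    propagator as [Xmx M z *m z], which holds since [M] commutes with every
    polynomial in [M] ([Xmx_mulmx]). *)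

Set Implicit Arguments.
Unset Strict Implicit.
Unset Printing Implicit Defensive.

Import Order.TTheory GRing.Theory Num.Theory.
Local Open Scope ring_scope.

Section DotProduct.
Variables (R : realType) (n : nat).
Implicit Types u v w : 'cV[R]_n.

Lemma dotC u v : dot u v = dot v u.
Proof. by apply: eq_bigr => k _; rewrite mulrC. Qed.

Lemma dotDl u v w : dot (u + v) w = dot u w + dot v w.
Proof.
by rewrite /dot -big_split; apply: eq_bigr => k _; rewrite mxE mulrDl.
Qed.

Lemma dotZl a u v : dot (a *: u) v = a * dot u v.
Proof.
by rewrite /dot mulr_sumr; apply: eq_bigr => k _; rewrite mxE mulrA.
Qed.

Lemma dotDr u v w : dot w (u + v) = dot w u + dot w v.
Proof. by rewrite dotC dotDl !(dotC _ w). Qed.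

Lemma dotZr a u v : dot u (a *: v) = a * dot u v.
Proof. by rewrite dotC dotZl dotC. Qed.

Lemma dot0l v : dot 0 v = 0.
Proof. by rewrite -(scale0r v) dotZl mul0r. Qed.

Lemma dotvv_neq0 v : v <> 0 -> dot v v != 0.
Proof.
move=> v_neq0; apply/eqP => /eqP.
rewrite psumr_eq0 => [|k _]; last by rewrite -expr2 sqr_ge0.
move=> /allP vk0; apply: v_neq0; apply/colP => k; rewrite mxE.
by have := vk0 k (mem_index_enum _); rewrite /= mulf_eq0 orbb => /eqP.
Qed.

Lemma orthogonal_comb_neq0 u v a b :
  u <> 0 -> dot u v = 0 -> a != 0 -> a *: u + b *: v <> 0.
Proof.
move=> u_neq0 uv0 a_neq0 /(congr1 (fun w => dot w u)).
rewrite dotDl !dotZl (dotC v) uv0 mulr0 addr0 dot0l => /eqP.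
by rewrite mulf_eq0 (negPf a_neq0) (negPf (dotvv_neq0 u_neq0)).
Qed.

End DotProduct.

Lemma weighted_sumsq_neq0 (R : realType) (a b c d : R) :
  a != 0 -> b != 0 -> (c != 0) || (d != 0) ->
  (a * c) ^+ 2 + (b * d) ^+ 2 != 0.
Proof.
move=> a0 b0 cd0; rewrite paddr_eq0 ?sqr_ge0 // !sqrf_eq0 !mulf_eq0.
by rewrite (negPf a0) (negPf b0) negb_and.
Qed.

Section PropagatorOnEigenvectors.
Variables (R : realType) (n : nat) (M : 'M[R]_n).
Implicit Types (v w : 'cV[R]_n) (m x y : R).

Lemma Amx_mulmx v : Amx M *m v = v - M *m v.
Proof. by rewrite /Amx mulmxBl mul1mx. Qed.

Lemma propagatorE v :
  propagator M v = M *m (v - alpha M v *: (Amx M *m v)).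
Proof. by rewrite /propagator /step -mulmxA mulmxBl mul1mx scalemxAl. Qed.

(** [step M v] is a polynomial in [M]. *)
Lemma step_mulmxC v : M *m step M v = step M v *m M.
Proof.
rewrite /step /Amx mulmxBr mulmxBl mulmx1 mul1mx -scalemxAr -scalemxAl.
by rewrite mulmxBr mulmxBl mulmx1 mul1mx.
Qed.

Lemma Xmx_mulmx v : Xmx M v *m v = propagator M (propagator M v).
Proof.
rewrite /Xmx {2}/propagator -!mulmxA; congr (M *m _).
by rewrite /propagator !mulmxA step_mulmxC.
Qed.

Lemma eigenvalue_neq1 m v :
  Amx M \in unitmx -> is_eigenvector M m v -> 1 - m != 0.
Proof.
move=> A_unit [v_neq0 Mv]; apply/eqP => m1; apply: v_neq0.
rewrite -(mulKmx A_unit v) Amx_mulmx Mv -{1}(scale1r v) -scalerBl m1.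
by rewrite scale0r mulmx0.
Qed.

(** The step length is then exactly [1 / (1 - m)], which solves the system for
    [A] along the line of [v]. *)
Lemma propagator_eigenvector m v :
  Amx M \in unitmx -> is_eigenvector M m v -> propagator M v = 0.
Proof.
move=> A_unit v_eigen; have a_neq0 := eigenvalue_neq1 A_unit v_eigen.
have [v_neq0 Mv] := v_eigen.
have Av : Amx M *m v = (1 - m) *: v.
  by rewrite Amx_mulmx Mv scalerBl scale1r.
have alphav : alpha M v = (1 - m)^-1.
  rewrite /alpha Av !dotZl dotZr; field.
  by rewrite a_neq0 dotvv_neq0.
by rewrite propagatorE alphav Av scalerA mulVf // scale1r subrr mulmx0.
Qed.

Variables (mi mj : R) (vi vj : 'cV[R]_n).
Hypotheses (A_unit : Amx M \in unitmx).
Hypotheses (vi_eigen : is_eigenvector M mi vi).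
Hypotheses (vj_eigen : is_eigenvector M mj vj).
Hypotheses (vij_orth : dot vi vj = 0) (vij_norm : dot vi vi = dot vj vj).

Let ai_neq0 : 1 - mi != 0 := eigenvalue_neq1 A_unit vi_eigen.
Let aj_neq0 : 1 - mj != 0 := eigenvalue_neq1 A_unit vj_eigen.

(** Since [vi] and [vj] have the same length, that length cancels in the step
    length, and [1 - alpha * (1 - mi)] and [1 - alpha * (1 - mj)] both become
    multiples of [mi - mj]. *)
Lemma propagator_pair x y : (x != 0) || (y != 0) ->
  propagator M (x *: vi + y *: vj) =
  (x * y * (mi - mj) /
     (((1 - mi) * x) ^+ 2 + ((1 - mj) * y) ^+ 2)) *:
    ((mi * (1 - mj) * y) *: vi - (mj * (1 - mi) * x) *: vj).
Proof.
move=> xy_neq0.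
(* The squared length of [A (x vi + y vj)], over that of [vi] and [vj]. *)
set den := (X in _ / X).
have den_neq0 : den != 0 by apply: weighted_sumsq_neq0.
have [vi_neq0 Mvi] := vi_eigen; have [_ Mvj] := vj_eigen.
have Mxy s t : M *m (s *: vi + t *: vj) = (s * mi) *: vi + (t * mj) *: vj.
  by rewrite mulmxDr -!scalemxAr Mvi Mvj !scalerA.
have Axy : Amx M *m (x *: vi + y *: vj) =
    (x * (1 - mi)) *: vi + (y * (1 - mj)) *: vj.
  rewrite Amx_mulmx Mxy opprD addrACA -!scalerBl.
  by rewrite !mulrBr !mulr1.
have alphaE : alpha M (x *: vi + y *: vj) =
    ((1 - mi) * x ^+ 2 + (1 - mj) * y ^+ 2) / den.
  rewrite /alpha Axy !(dotDl, dotDr, dotZl, dotZr) (dotC vj vi) vij_orth.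
  rewrite -vij_norm.
  set den' := (X in _ / X).
  have -> : den' = den * dot vi vi by rewrite /den' /den; ring.
  by field; rewrite den_neq0 dotvv_neq0.
rewrite propagatorE alphaE Axy scalerDr !scalerA opprD addrACA -!scalerBl Mxy.
rewrite scalerBr !scalerA -scaleNr.
by congr (_ *: _ + _ *: _); rewrite /den; field; exact: den_neq0.
Qed.

End PropagatorOnEigenvectors.

Theorem theorem4p1 (R : realType) (n : nat) (M : 'M[R]_n)
    (M_sym : M^T = M) (M_neq0 : M <> 0) (A_unit : Amx M \in unitmx)
    (ci cj mi mj : R) (vi vj : 'cV[R]_n)
    (ci_neq0 : ci <> 0) (cj_neq0 : cj <> 0)
    (vi_eigen : is_eigenvector M mi vi) (vj_eigen : is_eigenvector M mj vj)
    (vij_orth : dot vi vj = 0) :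
  let eps := cj / ci in
  let z := ci *: vi + cj *: vj in
  (mi = mj -> z <> 0 /\ propagator M z = 0) /\
  (mi <> mj -> dot vi vi = dot vj vj ->
    solves_nepv M z
      ((mj - mi) ^+ 2 / ((mi - 1) ^+ 2 + eps ^+ 2 * (mj - 1) ^+ 2) *
       ((mi * mj) ^+ 2 / (mi ^+ 2 + mj ^+ 2 / eps ^+ 2)))).
Proof.
move=> eps z.
have [vi_neq0 Mvi] := vi_eigen; have [_ Mvj] := vj_eigen.
move/eqP: ci_neq0 => ci0; move/eqP: cj_neq0 => cj0.
have z_neq0 : z <> 0 by apply: orthogonal_comb_neq0.
split=> [mij | /eqP mij vij_norm].
  split=> //; apply: (propagator_eigenvector (m := mi)) => //; split=> //.
  by rewrite mulmxDr -!scalemxAr Mvi Mvj mij scalerDr !scalerA !(mulrC mj).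
have ai0 := eigenvalue_neq1 A_unit vi_eigen.
have aj0 := eigenvalue_neq1 A_unit vj_eigen.
have mij0 : mi - mj != 0 by rewrite subr_eq0.
have m_neq0 : (mi != 0) || (mj != 0).
  by rewrite -negb_and; apply: contra mij => /andP[/eqP -> /eqP ->].
have D0 : ((1 - mi) * ci) ^+ 2 + ((1 - mj) * cj) ^+ 2 != 0.
  by apply: weighted_sumsq_neq0; rewrite ?ci0.
have E0 : (cj * mi) ^+ 2 + (ci * mj) ^+ 2 != 0.
  exact: weighted_sumsq_neq0.
pose k := ci * cj * (mi - mj) /
  (((1 - mi) * ci) ^+ 2 + ((1 - mj) * cj) ^+ 2).
have k0 : k != 0 by rewrite !mulf_neq0 ?invr_eq0.
(* With [k] opaque, [field] can cancel it as an atom. *)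
have kE := erefl k; rewrite {2}/k in kE; clearbody k.
pose x := k * (mi * (1 - mj) * cj); pose y := - (k * (mj * (1 - mi) * ci)).
have Rz : propagator M z = x *: vi + y *: vj.
  rewrite /z (propagator_pair A_unit vi_eigen vj_eigen) ?ci0 // -kE.
  by rewrite scalerBr !scalerA -scaleNr.
have xy0 : (x != 0) || (y != 0).
  rewrite /x /y oppr_eq0 !mulf_eq0 (negPf k0) (negPf ai0) (negPf aj0).
  by rewrite (negPf ci0) (negPf cj0) !orbF.
split=> //.
  rewrite Rz; case/orP: xy0 => [x0 | y0]; first exact: orthogonal_comb_neq0.
  rewrite addrC; apply: orthogonal_comb_neq0 => //; first by case: vj_eigen.
  by rewrite dotC.
rewrite Xmx_mulmx Rz (propagator_pair A_unit vi_eigen vj_eigen) //.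
(* The swap makes both terms share the factor [k (1 - mi) (1 - mj)]; its square
   cancels, so that [mi - 1] and [mj - 1] enter the eigenvalue through the first
   step only. *)
have DE : ((1 - mi) * x) ^+ 2 + ((1 - mj) * y) ^+ 2 =
    (k * (1 - mi) * (1 - mj)) ^+ 2 * ((cj * mi) ^+ 2 + (ci * mj) ^+ 2).
  by rewrite /x /y; ring.
rewrite DE /z scalerBr scalerDr !scalerA -scaleNr.
have lamE : (mj - mi) ^+ 2 / ((mi - 1) ^+ 2 + eps ^+ 2 * (mj - 1) ^+ 2) *
    ((mi * mj) ^+ 2 / (mi ^+ 2 + mj ^+ 2 / eps ^+ 2)) =
    k * (ci * cj * (mi - mj) * (mi * mj) ^+ 2) /
      ((cj * mi) ^+ 2 + (ci * mj) ^+ 2).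
  have -> : (mi - 1) ^+ 2 + eps ^+ 2 * (mj - 1) ^+ 2 =
      (((1 - mi) * ci) ^+ 2 + ((1 - mj) * cj) ^+ 2) / ci ^+ 2.
    by rewrite /eps; field.
  have -> : mi ^+ 2 + mj ^+ 2 / eps ^+ 2 =
      ((cj * mi) ^+ 2 + (ci * mj) ^+ 2) / cj ^+ 2.
    by rewrite /eps; field; rewrite ?ci0 ?cj0.
  by rewrite kE; field; rewrite ?ci0 ?cj0 ?D0 ?E0.
rewrite lamE /x /y.
by congr (_ *: _ + _ *: _); field; rewrite ?k0 ?ai0 ?aj0 ?E0.
Qed.
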